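(* Let $m$ be a positive integer. Suppose that for every positive integer $N$ and every $k\in[m]$, $X(k)_N=[x(k)_{ij,N}]_{1\le i,j\le N}$ is an $N\times N$ matrix with entries from $\mathcal{A}$ such that $\{x(k)_{ij,N}: i,j\in[N],\ k\in[m]\}$ is an identically distributed and Boolean independent family (i.e. different entries of the same matrix, as well as entries of different matrices, are identically distributed and Boolean independent), and such that each $x(k)_{ij,N}$ satisfies: 1. the limits $$\alpha_p=\lim_{N\to\infty}N\,\varphi\big((x(k)_{ij,N}x(k)_{ij,N}^* )^p\big),\qquad \beta_p=\lim_{N\to\infty}N\,\varphi\big((x(k)_{ij,N}^*x(k)_{ij,N})^p\big)$$ exist for each positive integer $p$; 2. $\displaystyle\lim_{N\to\infty}N^{\varepsilon}\,\varphi\big(x(k)_{ij,N}^{\xi_1}x(k)_{ij,N}^{\xi_2}\cdots x(k)_{ij,N}^{\xi_n}\big)=0$ for all $\varepsilon<1$, all $n\ge1$ and all $(\xi_1,\dots,\xi_n)\in\{1,*\}^n$. Then the family $\{X(k)_N: k\in[m]\}$ is asymptotically Boolean independent (as $N\to\infty$).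
   Context: $[N]=\{1,\dots,N\}$. A non-commutative probability space is a pair $(\mathcal{A},\varphi)$ with $\mathcal{A}$ a complex unital algebra and $\varphi:\mathcal{A}\to\mathbb{C}$ a unital $\mathbb{C}$-linear map; here $\mathcal{A}$ is moreover a $*$-algebra, and no positivity of $\varphi$ is required. $x^1=x$ and $x^*$ is the adjoint. Boolean independence: a family of (not necessarily unital) subalgebras $\{\mathcal{A}_j\}_j$ of $\mathcal{A}$ is Boolean independent with respect to $\varphi$ if $\varphi(a_1a_2\cdots a_r)=\varphi(a_1)\varphi(a_2)\cdots\varphi(a_r)$ for all $r\ge1$ whenever $a_k\in\mathcal{A}_{i(k)}$ and consecutive indices $i(k),i(k+1)$ are distinct. A family of variables is Boolean independent if the non-unital $*$-subalgebras they generate are Boolean independent. Variables $x,y$ are identically distributed if $\varphi(x^{\xi_1}\cdots x^{\xi_n})=\varphi(y^{\xi_1}\cdots y^{\xi_n})$ for all $n\geq 1$ and $\xi\in\{1,*\}^n$; in the claim this is for each fixed $N$. Random matrices: $M_N(\mathcal{A})$ is the algebra of $N\times N$ matrices over $\mathcal{A}$, with adjoint $(A^* )_{ij}=(a_{ji})^*$ and functional $\varphi\circ\mathrm{tr}(A)=\frac1N\sum_{i=1}^N\varphi(a_{ii})$. Asymptotic Boolean independence: a family $\{X_N(k):k\in[m]\}_{N\ge1}$ of $N\times N$ random matrices with entries in $\mathcal{A}$ is asymptotically Boolean independent if there exist a non-commutative probability space $(\mathcal{B},\psi)$, with $\mathcal{B}$ a $*$-algebra, and a Boolean independent family $(b_1,\dots,b_m)$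 from $\mathcal{B}$ such that for every non-commutative polynomial $p$ in $2m$ variables with complex coefficients $$\lim_{N\to\infty}\varphi\circ\mathrm{tr}\big(p(X_N(1),X_N(1)^*,\dots,X_N(m),X_N(m)^* )\big)=\psi\big(p(b_1,b_1^*,\dots,b_m,b_m^* )\big).$$ *)

(* Defs.v *)
From HB Require Import structures.
From mathcomp Require Import all_boot all_order all_algebra finmap.
From mathcomp Require Import complex.
From mathcomp Require Import all_classical all_reals all_analysis.

Set Implicit Arguments.
Unset Strict Implicit.
Unset Printing Implicit Defensive.

Import Order.TTheory GRing.Theory Num.Theory.
Import numFieldNormedType.Exports.

Local Open Scope classical_set_scope.
Local Open Scope ring_scope.

HB.mixin Record Algebra_isStarAlgebra (C : numClosedFieldType) A
    of GRing.Algebra C A := {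
  star : A -> A ;
  starK : involutive star ;
  starD : forall a b, star (a + b) = star a + star b ;
  starZ : forall (c : C) a, star (c *: a) = c^* *: star a ;
  starM : forall a b, star (a * b) = star b * star a
}.

#[short(type="starAlgType")]
HB.structure Definition StarAlgebra (C : numClosedFieldType) :=
  {A of GRing.Algebra C A & Algebra_isStarAlgebra C A}.

(* The exponent xi in {1, *} is a boolean: false stands for 1, true for *. *)
Definition starpow (T : Type) (adj : T -> T) (xi : bool) (a : T) : T :=
  if xi then adj a else a.

Section Independence.
Context {C : numClosedFieldType} {A : starAlgType C}.

(* No unit is required: 1 need not belong to S. *)
Definition nonunital_star_subalgebra (S : set A) : Prop :=
  [/\ S 0,
      forall a b, S a -> S b -> S (a + b),
      forall (c : C) a, S a -> S (c *: a),
      forall a b, S a -> S b -> S (a * b)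
    & forall a, S a -> S (star a)].

Definition star_generated (a : A) : set A :=
  smallest nonunital_star_subalgebra [set a].

Variable phi : {scalar A}.

Definition boolean_independent (J : Type) (S : J -> set A) : Prop :=
  forall (r : nat) (i : nat -> J) (a : nat -> A), (0 < r)%N ->
    (forall k, (k < r)%N -> S (i k) (a k)) ->
    (forall k, (k.+1 < r)%N -> i k <> i k.+1) ->
    phi (\prod_(k < r) a k) = \prod_(k < r) phi (a k).

Definition boolean_independent_vars (J : Type) (x : J -> A) : Prop :=
  boolean_independent (fun j => star_generated (x j)).

Definition star_moment (xi : seq bool) (a : A) : C :=
  phi (\prod_(e <- xi) starpow star e a).

Definition identically_distributed (a b : A) : Prop :=
  forall xi : seq bool, xi <> [::] -> star_moment xi a = star_moment xi b.

End Independence.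

(* Non-commutative polynomials in x_1, x_1^*, ..., x_m, x_m^*, as finitely
   supported coefficient functions on words; the letter (k, false) stands for
   x_k and (k, true) for x_k^*. *)
Definition ncpoly (C : numClosedFieldType) (m : nat) : Type :=
  {fsfun seq ('I_m * bool)%type -> C with 0}.

(* The scaling is a parameter because 'M[A]_N carries in the library only the
   structure of a module over A, not over C. *)
Definition nceval (C : numClosedFieldType) (S : pzRingType)
    (scale : C -> S -> S) (adj : S -> S) (m : nat)
    (p : ncpoly C m) (b : 'I_m -> S) : S :=
  \sum_(w <- finsupp p) scale (p w) (\prod_(l <- w) starpow adj l.2 (b l.1)).

Section RandomMatrices.
Context {C : numClosedFieldType} {A : starAlgType C} {N : nat}.

Definition cscalemx (c : C) (M : 'M[A]_N) : 'M[A]_N :=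
  map_mx (fun a => c *: a) M.

Definition starmx (M : 'M[A]_N) : 'M[A]_N := \matrix_(i, j) star (M j i).

Definition trstate (phi : {scalar A}) (M : 'M[A]_N) : C :=
  N%:R^-1 * \sum_(i < N) phi (M i i).

End RandomMatrices.

(* R[i]^o is R[i] with the topology given by the modulus. *)
Definition ccvg (R : realType) (u : nat -> R[i]) (l : R[i]) : Prop :=
  (u : nat -> R[i]^o) @ \oo --> (l : R[i]^o).

(* The value at N = 0 is irrelevant to the limit. *)
Definition asymptotically_boolean_independent (R : realType)
    (A : starAlgType R[i]) (phi : {scalar A}) (m : nat)
    (X : forall N : nat, 'I_m -> 'M[A]_N) : Prop :=
  exists (B : starAlgType R[i]) (psi : {scalar B}) (b : 'I_m -> B),
    [/\ psi 1 = 1,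
        boolean_independent_vars psi b
      & forall p : ncpoly R[i] m,
          ccvg (fun N => trstate phi (nceval cscalemx starmx p (X N)))
               (psi (nceval *:%R star p b))].

(* Main.v *)
Require Import Defs.
From HB Require Import structures.
From mathcomp Require Import all_boot all_order all_algebra finmap.
From mathcomp Require Import complex.
From mathcomp Require Import all_classical all_reals all_analysis ring.
From mathcomp.multinomials Require Import -(notations) monalg.

(* By Boolean independence the phi-moment of a word in matrix entries is a sum
   over its factorizations into consecutive blocks, each block running over a
   single entry and weighted by its Boolean cumulant; no maximality of the
   blocks is required. Summed over the indices, a block with letters of a
   single matrix X(k) therefore contributes an N x N matrix: its cumulant times
   the all-ones matrix J if its exponents alternate and its length is odd,
   N times the identity if they alternate and its length is even, and the
   identity otherwise. All of these commute, so the matrix of moments of a word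
   is P + N^-1 (S - P) J, where P and S are its eigenvalues off and on the
   constant vectors; each obeys a scalar recursion over prefixes of the word,
   and the normalized trace is P + N^-1 (S - P).

   Cumulants are o(N^-e) for every e < 1, and N times the cumulant of an
   alternating block of length 2p tends to alpha_p or beta_p. Hence S grows
   slower than every positive power of N, and P converges to the solution L of
   the same recursion with weights alpha_p, beta_p on alternating even blocks
   of a single index k. As mixed blocks have weight 0, L factorizes between
   letters of different index, which makes the generators of the free
   *-algebra Boolean independent for the linear extension of L. *)

Set Implicit Arguments.
Unset Strict Implicit.
Unset Printing Implicit Defensive.

Import Order.TTheory GRing.Theory Num.Theory.
Import numFieldNormedType.Exports.

Local Open Scope ring_scope.

(** * Renewal equations and Boolean cumulants *)

Section Renewal.
Variables (C : comNzRingType) (T : Type).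
Implicit Types (g : seq T -> C) (w : seq T).

(* The solution of [f nil = 1] and [f w = sum_k g (take k w) * f (drop k w)],
   [k] ranging over [1, size w]; the first argument of [renewal_rec] is fuel. *)
Fixpoint renewal_rec g (n : nat) w : C :=
  if n is n'.+1 then
    if w is [::] then 1 else
    \sum_(1 <= k < (size w).+1) g (take k w) * renewal_rec g n' (drop k w)
  else 1.

Definition renewal g w := renewal_rec g (size w) w.

Lemma renewal_nil g : renewal g [::] = 1.
Proof. by []. Qed.

Lemma renewal_recE g n w : (size w <= n)%N -> renewal_rec g n w = renewal g w.
Proof.
rewrite /renewal; elim: n {-2}n (leqnn n) w => [|N IH] n nN w wn.
  by move: wn; rewrite (eqP (_ : n == 0)%N) -?leqn0 // leqn0 => /eqP ->.
case: n nN wn => [|n] nN wn; first by move: wn; rewrite leqn0 => /eqP ->.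
case: w wn => [//|l w] wn; rewrite [size _]/=.
rewrite [LHS]/= [RHS]/=; apply: eq_big_nat => -[//|k] /andP[_ kw]; congr (_ * _).
have kn : (size (drop k w) <= n)%N by rewrite size_drop (leq_trans (leq_subr _ _)).
have kw' : (size (drop k w) <= size w)%N by rewrite size_drop leq_subr.
by rewrite /= (IH n) // (IH (size w)) //; exact: leq_trans wn nN.
Qed.

Lemma renewalE g w : w <> [::] ->
  renewal g w = \sum_(1 <= k < (size w).+1) g (take k w) * renewal g (drop k w).
Proof.
case: w => [//|l w] _; rewrite /renewal [LHS]/=; apply: eq_big_nat => -[//|k] _.
by rewrite /= renewal_recE // size_drop leq_subr.
Qed.

Lemma renewal_unique g (f : seq T -> C) : f [::] = 1 ->
  (forall w, w <> [::] ->
    f w = \sum_(1 <= k < (size w).+1) g (take k w) * f (drop k w)) ->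
  f =1 renewal g.
Proof.
move=> f0 fE w; have [n] := ubnP (size w); elim: n w => // n IH [|l w] wn //.
rewrite fE // renewalE //; apply: eq_big_nat => -[//|k] _; congr (_ * _).
apply: IH; rewrite size_drop /= subSS.
by rewrite (leq_ltn_trans (leq_subr _ _)).
Qed.

(* Boolean cumulants: the interval-partition moment-cumulant formula says that
   the moments are the renewal of the cumulants. *)
Section Cumulant.
Variable m : seq T -> C.

Fixpoint cumulant_rec n w : C :=
  if n is n'.+1 then
    m w - \sum_(1 <= k < size w) cumulant_rec n' (take k w) * m (drop k w)
  else m w.

Definition cumulant w := cumulant_rec (size w) w.

Lemma cumulant_recE n w : (size w <= n)%N -> cumulant_rec n w = cumulant w.
Proof.
rewrite /cumulant; elim: n {-2}n (leqnn n) w => [|N IH] n nN w wn.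
  by move: wn; rewrite (eqP (_ : n == 0)%N) -?leqn0 // leqn0 => /eqP ->.
case: n nN wn => [|n] nN wn; first by move: wn; rewrite leqn0 => /eqP ->.
case: w wn => [|l w] wn; first by rewrite /= big_geq // subr0.
rewrite [LHS]/= [RHS]/=; congr (_ - _); apply: eq_big_nat => k /andP[_ kw].
have tk : size (take k (l :: w)) = k by rewrite size_takel // ltnW.
congr (_ * _); rewrite !IH // ?tk //; last by rewrite -ltnS (leq_trans kw).
exact: leq_trans wn nN.
Qed.

Lemma cumulantE w :
  cumulant w = m w - \sum_(1 <= k < size w) cumulant (take k w) * m (drop k w).
Proof.
rewrite /cumulant; case: w => [|l w]; first by rewrite /= big_geq // subr0.
rewrite [LHS]/=; congr (_ - _); apply: eq_big_nat => k /andP[_ kw].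
by rewrite cumulant_recE // size_takel // ltnW.
Qed.

(** Since [m [::] = 1], the summand for the full word is the cumulant itself, and [cumulantE] is the
    renewal equation solved for it. *)
Lemma renewal_cumulant : m [::] = 1 -> renewal cumulant =1 m.
Proof.
move=> m1 w; apply/esym; move: w; apply: renewal_unique => // -[//|l w] _.
rewrite big_nat_recr //= take_size drop_size m1 mulr1.
by rewrite [in cumulant (l :: w)]cumulantE [size _]/= addrCA subrr addr0.
Qed.

End Cumulant.
End Renewal.

(** * Factorization of moments and vanishing of mixed cumulants *)

Section BooleanFactorization.
Variables (C : comNzRingType) (J S : eqType).
Local Notation letter := (J * S)%type.
Implicit Types (u v w : seq letter) (M g : seq letter -> C).

Definition monochrome w := constant [seq l.1 | l <- w].

(** Boolean independence read on words: only the two letters at the cut must differ, whatever else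
    [u] and [v] contain. *)
Definition factorizing M := forall (l : letter) u (l' : letter) v, l.1 != l'.1 ->
  M (rcons u l ++ l' :: v) = M (rcons u l) * M (l' :: v).

Lemma monochrome_cons (l : letter) w :
  monochrome (l :: w) = all (fun l' => l'.1 == l.1) w.
Proof. by rewrite /monochrome /= all_map. Qed.

Lemma monochromeP w :
  reflect {in w &, forall l l' : letter, l.1 = l'.1} (monochrome w).
Proof.
case: w => [|l w]; first by apply: ReflectT => l'; rewrite in_nil.
rewrite monochrome_cons; apply: (iffP allP) => [lw l1 l2|lw l' l'w].
  have lE l' : l' \in l :: w -> l'.1 = l.1.
    by rewrite inE => /predU1P[->|/lw/eqP].
  by move=> /lE -> /lE ->.
by apply/eqP/lw; rewrite inE ?l'w ?eqxx ?orbT.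
Qed.

(** A block straddling the cut contains both [l] and [l'], so it is mixed and has weight 0. The
    first block thus ends at or before the cut, and removing it leaves a shorter instance. *)
Lemma renewal_factorizing g :
  (forall w, ~~ monochrome w -> g w = 0) -> factorizing (renewal g).
Proof.
move=> g0 l u l' v ll'; have [n] := ubnP (size u).
elim: n u => // n IH u un.
rewrite renewalE; last by case: (u).
rewrite size_cat (@big_cat_nat _ _ _ (size (rcons u l)).+1) //=; last first.
  by rewrite ltnS leq_addr.
rewrite [X in _ + X]big_nat_cond [X in _ + X]big1 ?addr0; last first.
  move=> k; rewrite andbT => /andP[uk kuv].
  rewrite g0 ?mul0r //; apply/negP => /monochromeP/(_ l l') H.
  move/eqP: ll'; apply; apply: H.
    by rewrite take_cat ltnNge ltnW //= mem_cat mem_rcons inE eqxx.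
  rewrite take_cat ltnNge ltnW //= mem_cat -[(k - _)%N]prednK ?subn_gt0 //.
  by rewrite /= inE eqxx orbT.
rewrite renewalE; last by case: (u).
rewrite mulr_suml; apply: eq_big_nat => -[//|k] /andP[_].
rewrite ltnS size_rcons ltnS => ku; rewrite -mulrA.
rewrite takel_cat ?size_rcons // drop_cat size_rcons ltnS.
congr (_ * _); rewrite leq_eqVlt in ku.
case/predU1P: ku => [->|ku].
  by rewrite ltnn subnn drop0 -(size_rcons u l) drop_size renewal_nil mul1r.
rewrite ku drop_rcons // IH // size_drop.
by rewrite (leq_trans _ (un : size u <= n)%N) // ltn_subrL (leq_ltn_trans _ ku).
Qed.

Lemma monochrome_prefix (j : J) w : exists u v,
  [/\ w = u ++ v, all (fun l => l.1 == j) u &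
      forall l' v', v = l' :: v' -> l'.1 != j].
Proof.
elim: w => [|l w [u [v [-> uj vj]]]]; first by exists nil, nil.
have [lj|lj] := eqVneq l.1 j.
  by exists (l :: u), v; split=> //=; rewrite lj eqxx.
by exists nil, (l :: u ++ v); split=> // l' v' [<- _].
Qed.

Definition monochrome_weight (h : seq S -> C) w : C :=
  if monochrome w then h [seq l.2 | l <- w] else 0.

(* Boolean independence as the vanishing of mixed Boolean cumulants. *)
Lemma factorizing_renewal (m : seq S -> C) M : m [::] = 1 ->
  (forall w, monochrome w -> M w = m [seq l.2 | l <- w]) -> factorizing M ->
  M =1 renewal (monochrome_weight (cumulant m)).
Proof.
rewrite /monochrome_weight.
move=> m1 Mm MM; have M1 : M [::] = 1 by rewrite Mm.
apply: renewal_unique => // -[//|l w] _.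
have [u [v [-> uj vj]]] := monochrome_prefix l.1 w.
(* [v] begins with an index other than [l.1], so [M] splits between any suffix of the run [l :: u]
   and [v]; [M [::] = 1] covers the empty cases. *)
have Muv k : M (drop k (l :: u) ++ v) = M (drop k (l :: u)) * M v.
  case: v vj => [|l' v] vj; first by rewrite cats0 M1 mulr1.
  case/lastP: (drop k _) (mem_drop (s := l :: u) (n0 := k)) => [|u' l0] us.
    by rewrite M1 mul1r.
  rewrite MM //; have := us l0; rewrite mem_rcons inE eqxx => /(_ isT).
  rewrite inE eq_sym => /orP[/eqP <-|/(allP uj)/eqP ->].
    by rewrite eq_sym (vj l' v).
  by rewrite eq_sym (vj l' v).
have lu : all (fun l' => l'.1 == l.1) (l :: u) by rewrite /= eqxx.
have mono k : monochrome (take k (l :: u)).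
  apply/monochromeP => l1 l2 /mem_take/(allP lu)/eqP -> /mem_take.
  by move=> /(allP lu)/eqP ->.
have monod k : monochrome (drop k (l :: u)).
  apply/monochromeP => l1 l2 /mem_drop/(allP lu)/eqP -> /mem_drop.
  by move=> /(allP lu)/eqP ->.
rewrite -cat_cons size_cat (@big_cat_nat _ _ _ (size (l :: u)).+1) //=; last first.
  by rewrite ltnS leq_addr.
(* A longer prefix contains [l] and the first letter of [v], so it is mixed and weighs 0. *)
rewrite [X in _ + X]big_nat_cond [X in _ + X]big1 ?addr0; last first.
  move=> k; rewrite andbT => /andP[uk kuv].
  have vk : (0 < k - (size u).+1)%N by rewrite subn_gt0.
  case: v vj Muv kuv => [|l' v] vj Muv kuv; first by rewrite addn0 ltnNge uk in kuv.
  rewrite ifF ?mul0r //; apply/negP => /monochromeP/(_ l l') H.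
  move/eqP: (vj l' v erefl); apply; apply/esym/H.
    by rewrite -cat_cons take_cat ltnNge ltnW //= inE eqxx.
  rewrite -cat_cons take_cat ltnNge ltnW //= -[(k - _)%N]prednK //.
  by rewrite inE mem_cat inE eqxx !orbT.
have := Muv 0%N; rewrite drop0 => ->.
rewrite Mm -?(renewal_cumulant m1) ?renewalE //; last by rewrite -(take_size (l :: u)).
rewrite mulr_suml size_map; apply: eq_big_nat => -[//|k] /andP[_].
rewrite ltnS => ku; rewrite -mulrA.
rewrite -[l :: u ++ v]cat_cons takel_cat // mono map_take; congr (_ * _).
rewrite -map_drop renewal_cumulant // -Mm // -Muv.
rewrite [in RHS]drop_cat; case: ifP => // /negbT; rewrite -leqNgt => uk.
have -> : k.+1 = size (l :: u) by apply/anti_leq; rewrite ku.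
by rewrite drop_size subnn drop0.
Qed.

End BooleanFactorization.

(** * Words in matrix entries *)

Section MatrixWords.
Variables (I : eqType) (N : nat).
Local Notation var := (I * ('I_N * 'I_N))%type.
Implicit Types (e f g : 'I_N) (l : I * bool) (u v w : seq (I * bool)).

Definition entry l e g : var * bool :=
  ((l.1, if l.2 then (g, e) else (e, g)), l.2).

(* The words in matrix entries whose sum is the entry [(e, f)] of the word [w]
   in matrices; a starred letter reads the transposed position. *)
Fixpoint paths w e f : seq (seq (var * bool)) :=
  if w is l :: w' then
    flatten [seq [seq entry l e g :: s | s <- paths w' g f] | g <- enum 'I_N]
  else if e == f then [:: [::]] else [::].

Section Sums.
Variable V : nmodType.
Implicit Types h : seq (var * bool) -> V.

Lemma sum_paths_nil e f h :
  \sum_(s <- paths [::] e f) h s = if e == f then h [::] else 0.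
Proof. by rewrite /=; case: eqP => _; rewrite ?big_seq1 ?big_nil. Qed.

Lemma sum_paths_cons l w e f h :
  \sum_(s <- paths (l :: w) e f) h s =
  \sum_g \sum_(s <- paths w g f) h (entry l e g :: s).
Proof.
rewrite /= big_flatten big_map big_enum /=.
by apply: eq_bigr => g _; rewrite big_map.
Qed.

(** Cutting at a letter position inserts a sum over the intermediate index, as in a matrix
    product. *)
Lemma sum_paths_cat u v e f h :
  \sum_(s <- paths (u ++ v) e f) h s =
  \sum_g \sum_(s <- paths u e g) \sum_(t <- paths v g f) h (s ++ t).
Proof.
elim: u e h => [|l u IH] e h.
  rewrite [RHS](eq_bigr (fun g => if g == e then
      \sum_(t <- paths v g f) h t else 0)) => [|g _].
    by rewrite -big_mkcond /= big_pred1_eq.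
  by rewrite sum_paths_nil eq_sym.
rewrite cat_cons sum_paths_cons.
rewrite [RHS](eq_bigr _ (fun g _ => sum_paths_cons _ _ _ _ _)).
rewrite exchange_big /=; apply: eq_bigr => g _; exact: IH.
Qed.

End Sums.

Lemma paths_exponents w e f s : s \in paths w e f ->
  [seq y.2 | y <- s] = [seq l.2 | l <- w].
Proof.
elim: w e s => [|l w IH] e s /=; first by case: eqP => // _; rewrite inE => /eqP ->.
by move=> /flatten_mapP[g _ /mapP[t /IH tw ->]]; rewrite /= tw.
Qed.

Lemma paths_indices w e f s : s \in paths w e f ->
  [seq y.1.1 | y <- s] = [seq l.1 | l <- w].
Proof.
elim: w e s => [|l w IH] e s /=; first by case: eqP => // _; rewrite inE => /eqP ->.
by move=> /flatten_mapP[g _ /mapP[t /IH tw ->]]; rewrite /= tw.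
Qed.

Lemma paths_size w e f s : s \in paths w e f -> size s = size w.
Proof. by move/paths_exponents/(congr1 size); rewrite !size_map. Qed.

Section Algebra.
Variables (C : numClosedFieldType) (A : starAlgType C).
Variable x : I -> 'I_N -> 'I_N -> A.

Lemma mx_word_entry w e f :
  (\prod_(l <- w) starpow (@starmx C A N) l.2 (\matrix_(i, j) x l.1 i j)) e f =
  \sum_(s <- paths w e f)
    \prod_(y <- s) starpow star y.2 (x y.1.1 y.1.2.1 y.1.2.2).
Proof.
elim: w e => [|l w IH] e.
  by rewrite big_nil sum_paths_nil big_nil mxE; case: eqP.
rewrite big_cons mxE sum_paths_cons; apply: eq_bigr => g _.
rewrite IH mulr_sumr; apply: eq_bigr => s _; rewrite big_cons; congr (_ * _).
by case: l => k [] /=; rewrite !mxE.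
Qed.

End Algebra.

Section Counting.
Variable C : numFieldType.

Definition alternating_seq (xi : seq bool) := sorted (fun b c => b != c) xi.

(** When all entries sit at position [(a, c)], an unstarred letter leads from [a] to [c] and a
    starred one from [c] to [a], so at most one path exists. Neighbours with equal exponents force
    [a = c]. *)
Lemma count_paths_var (k : I) (a c : 'I_N) w e f :
  all (fun l => l.1 == k) w ->
  \sum_(s <- paths w e f) (all (fun y => y.1 == (k, (a, c))) s)%:R =
  (if w is l :: w' then
     [&& e == (if l.2 then c else a),
         path (fun b c => b != c) l.2 [seq l.2 | l <- w'] || (a == c) &
         f == (if last l.2 [seq l.2 | l <- w'] then a else c)]
   else e == f)%:R :> C.
Proof.
elim: w e => [|l w IH] e; first by rewrite sum_paths_nil; case: eqP.
move=> /= /andP[/eqP lk wk]; rewrite sum_paths_cons /=.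
rewrite (bigD1 (if l.2 then a else c)) //= [X in _ + X]big1 ?addr0; last first.
  move=> g ng; rewrite big1 // => s _; rewrite /entry /= xpair_eqE.
  case: (l.2) ng => ng; rewrite xpair_eqE /= ?(negPf ng) ?andbF //.
rewrite (eq_bigr (fun s => (e == if l.2 then c else a)%:R *
    (all (fun y => y.1 == (k, (a, c))) s)%:R)) => [|s _]; last first.
  by rewrite -natrM mulnb /= lk; case: (l.2); rewrite !xpair_eqE !eqxx ?andbT.
rewrite -mulr_sumr IH //; case: (e == _); rewrite /= ?mul0r ?mul1r //.
case: w {IH wk} => [|l' w] /=; first by rewrite [f == _]eq_sym.
case: (l.2); case: (l'.2) => /=; rewrite ?eqxx //=.
  by case: (eqVneq a c) => [->|]; rewrite ?eqxx ?orbT.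
by rewrite [c == a]eq_sym; case: (eqVneq a c) => [->|]; rewrite ?eqxx ?orbT.
Qed.

Lemma last_alternating b xi :
  path (fun b c => b != c) b xi -> last b xi = b (+) odd (size xi).
Proof.
elim: xi b => [|c xi IH] b /=; first by rewrite addbF.
by move=> /andP[bc /IH ->]; move: bc; case: b; case: c; case: odd.
Qed.

(** The first letter and its end index [g] fix the common variable, and [g] is the only freedom. An
    alternating path bounces between [e] and [g]: an odd length ends at [g = f], one choice; an even
    length returns to [e] and leaves [g] free, hence the factor [N]. A repeated exponent forces
    [g = e]. *)
Lemma count_monochrome_paths w e f : w <> [::] ->
  \sum_(s <- paths w e f) (monochrome s)%:R =
  (if monochrome w then
     if alternating_seq [seq l.2 | l <- w] then
       if odd (size w) then 1 else N%:R * (e == f)%:R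
     else (e == f)%:R
   else 0) :> C.
Proof.
case: w => [//|l w] _; case: ifPn => [mw|/negP mw]; last first.
  rewrite big_seq big1 // => s /paths_indices sw.
  case: (boolP (monochrome s)) => // ms; exfalso; apply: mw.
  apply/monochromeP => l1 l2 /(map_f fst) + /(map_f fst); rewrite -sw.
  move=> /mapP[y ys ->] /mapP[y' y's ->].
  by rewrite (elimT (monochromeP _) ms y y').
pose b := l.2; pose xi := [seq l'.2 | l' <- w].
rewrite sum_paths_cons (eq_bigr (fun g =>
    ((path (fun b c => b != c) b xi || (e == g)) &&
     (f == if last b xi == b then g else e))%:R)) => [|g _]; last first.
  under eq_bigr do rewrite monochrome_cons /entry /=.
  move: mw; rewrite monochrome_cons /b /xi => mw.
  have -> : (if l.2 then (g, e) else (e, g)) =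
    (if l.2 then g else e, if l.2 then e else g) by case: (l.2).
  rewrite count_paths_var //.
  case: w {xi mw} => [|l' w] /=; first by rewrite eqxx eq_sym.
  case: (l.2); case: (l'.2); rewrite /= ?[g == e]eq_sym;
  by case: (eqVneq e g) => [->|ne]; rewrite ?eqxx ?orbT ?orbF //=; case: (last _ _).
rewrite /alternating_seq /= -/b -/xi; case: ifP => [alt|_].
  rewrite (last_alternating alt) size_map.
  under eq_bigr do rewrite orTb.
  case: (odd (size w)); rewrite ?addbT ?addbF ?eqxx /=.
    by case: (b); rewrite /= mulr_natl sumr_const [#|_|]card_ord [f == e]eq_sym.
  by rewrite (bigD1 f) //= eqxx big1 ?addr0 // => g; rewrite eq_sym => /negPf ->.
rewrite (bigD1 e) //= eqxx if_same [f == e]eq_sym big1 ?addr0 // => g.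
by rewrite eq_sym => /negPf ->.
Qed.

End Counting.
End MatrixWords.

(** * Moments of words in Boolean independent variables *)

Section EntryMoments.
Variables (C : numClosedFieldType) (A : starAlgType C) (phi : {scalar A}).
Local Notation adj := (@star C A).
Local Notation star_gen := (@star_generated C A).

Lemma boolean_independent_seq (J : eqType) (S : J -> set A) (s : seq (J * A)) :
  phi 1 = 1 -> boolean_independent phi S -> {in s, forall b, S b.1 b.2} ->
  sorted (fun i j => i != j) [seq b.1 | b <- s] ->
  phi (\prod_(b <- s) b.2) = \prod_(b <- s) phi b.2.
Proof.
case: s => [|b0 s] phi1 indep sS ss; first by rewrite !big_nil.
set s' := b0 :: s in sS ss *.
rewrite !(big_nth b0) !big_mkord.
apply: (indep _ (fun k => (nth b0 s' k).1) (fun k => (nth b0 s' k).2)) => // k ks.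
  exact/sS/mem_nth.
move: ss => /(sortedP b0.1)/(_ k); rewrite size_map => /(_ ks).
by rewrite !(nth_map b0) ?(ltnW ks) // => /eqP.
Qed.

Section Blocks.
Variables (J : eqType) (x : J -> A).
Implicit Types s : seq (J * bool).

Definition word_prod s := \prod_(y <- s) starpow adj y.2 (x y.1).

Lemma star_generated_starpow e a : star_gen a (starpow adj e a).
Proof.
move=> T [[_ _ _ _ Tstar] aT]; have Ta : T a by exact: aT.
by case: e => //=; exact: Tstar.
Qed.

Lemma star_generatedM a b c : star_gen a b -> star_gen a c ->
  star_gen a (b * c).
Proof.
move=> gb gc T TT; have [[_ _ _ TM _] _] := TT.
by apply: TM; [exact: gb | exact: gc].
Qed.

(** Maximal runs of one variable merge into a single element of its generated star-subalgebra.
    Tracking the first and last variable lets two block lists be concatenated. *)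
Lemma word_blocks s : exists bs : seq (J * A),
  [/\ word_prod s = \prod_(b <- bs) b.2,
      {in bs, forall b, star_gen (x b.1) b.2},
      sorted (fun i j => i != j) [seq b.1 | b <- bs],
      forall j, head j [seq b.1 | b <- bs] = head j [seq y.1 | y <- s] &
      (bs == [::]) = (s == [::]) /\
      forall j, last j [seq b.1 | b <- bs] = last j [seq y.1 | y <- s]].
Proof.
rewrite /word_prod.
elim: s => [|y s [[|b bs] [bsE bsS bss bsh [bs0 bsl]]]].
- by exists [::]; split; rewrite ?big_nil.
- have {bs0} s0 : s = [::] by apply/eqP; rewrite -bs0.
  exists [:: (y.1, starpow adj y.2 (x y.1))]; rewrite s0; split=> //.
    by rewrite !big_seq1.
  by move=> c; rewrite inE => /eqP ->; exact: star_generated_starpow.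
have [yb|yb] := eqVneq y.1 b.1.
  exists ((b.1, starpow adj y.2 (x y.1) * b.2) :: bs); split=> //=.
  - by rewrite big_cons bsE !big_cons mulrA.
  - move=> c; rewrite inE => /predU1P[->|cbs]; last first.
      by apply: bsS; rewrite inE cbs orbT.
    rewrite yb; apply: star_generatedM; first exact: star_generated_starpow.
    exact: (bsS b (mem_head _ _)).
  - split=> // j; move: (bsl y.1) bs0 => /=.
    case: (s) => //= z t <-; by rewrite yb.
exists ((y.1, starpow adj y.2 (x y.1)) :: b :: bs); split=> //=.
- by rewrite big_cons bsE [in RHS]big_cons.
- move=> c; rewrite inE => /predU1P[->|/bsS //]; exact: star_generated_starpow.
- by rewrite yb.
by split=> // j; rewrite -bsl.
Qed.

Hypothesis phi1 : phi 1 = 1.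
Hypothesis x_indep : boolean_independent_vars phi x.

(** As [l] and [l'] differ, the two block lists join without merging, and independence applies to
    each list and to their concatenation. *)
Lemma word_prod_factorizing : factorizing (fun s => phi (word_prod s)).
Proof.
move=> l u l' v ll'.
have [bs [bsE bsS bss _ [bs0 bsl]]] := word_blocks (rcons u l).
have [cs [csE csS css csh [cs0 _]]] := word_blocks (l' :: v).
have -> : word_prod (rcons u l ++ l' :: v) = \prod_(b <- bs ++ cs) b.2.
  by rewrite /word_prod !big_cat /= -bsE -csE.
rewrite bsE csE !(boolean_independent_seq phi1 x_indep) ?big_cat //.
  by move=> b; rewrite mem_cat => /orP[/bsS|/csS].
rewrite map_cat.
case: bs bss bs0 bsl {bsE bsS} => [|b bs]; first by case: (u).
case: cs css csh cs0 {csE csS} => [|c cs] // css csh _ bss _ bsl.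
rewrite /= cat_path [path _ b.1 _]bss /= [path _ c.1 _]css andbT.
have := bsl b.1; rewrite map_rcons last_rcons /= => ->.
by have := csh b.1 => /= ->.
Qed.

Lemma word_prod_monochrome (a : A) s :
  (forall j, identically_distributed phi (x j) a) -> monochrome s ->
  phi (word_prod s) = star_moment phi [seq y.2 | y <- s] a.
Proof.
case: s => [|y s] xa; first by rewrite /word_prod /star_moment !big_nil.
move=> /monochromeP ms; rewrite -(xa y.1) // /star_moment big_map.
congr (phi _); apply: eq_big_seq => z zs.
by rewrite (ms z y) // inE eqxx.
Qed.

Lemma word_prod_renewal (a : A) :
  (forall j, identically_distributed phi (x j) a) ->
  (fun s => phi (word_prod s)) =1 
    renewal (monochrome_weight (cumulant (star_moment phi ^~ a))).
Proof.
move=> xa; apply: factorizing_renewal.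
- by rewrite /star_moment big_nil.
- by move=> s ms; rewrite (word_prod_monochrome xa).
exact: word_prod_factorizing.
Qed.

End Blocks.

End EntryMoments.

(** * Path sums in the commutative algebra spanned by the identity and [J] *)

Section TransferMatrix.
Variables (C : numFieldType) (I : eqType) (cum : seq bool -> C) (N : nat).
Implicit Types (w : seq (I * bool)).

(* On the nonempty word [u] the paths from [e] to [f] whose entries all
   coincide have total cumulant given by the matrix
   [diag_weight u *: 1 + N^-1 * (ones_weight u - diag_weight u) *: J],
   [J] the all-ones matrix; [diag_weight] and [ones_weight] are thus the
   eigenvalues off and on the constant vectors. *)
Definition diag_weight w : C :=
  let xi := [seq l.2 | l <- w] in
  if monochrome w then
    if alternating_seq xi then (if odd (size w) then 0 else N%:R * cum xi)
    else cum xi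
  else 0.

Definition ones_weight w : C :=
  let xi := [seq l.2 | l <- w] in
  if monochrome w then (if alternating_seq xi then N%:R * cum xi else cum xi) else 0.

(** As [J] squares to [N] times [J], matrices of this shape multiply by multiplying eigenvalues: [a]
    and [p] off the constant vectors, [b] and [q] on them. *)
Lemma sum_transfer (a b p q : C) (e f : 'I_N) :
  \sum_g (a * (e == g)%:R + N%:R^-1 * (b - a)) *
         (p * (g == f)%:R + N%:R^-1 * (q - p)) =
  a * p * (e == f)%:R + N%:R^-1 * (b * q - a * p).
Proof.
have N0 : N%:R != 0 :> C by rewrite pnatr_eq0; case: N e {f} => // -[].
have S1 : \sum_g (e == g)%:R = 1 :> C.
  by rewrite (bigD1 e) //= eqxx big1 ?addr0 // => g; rewrite eq_sym => /negPf ->.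
have S2 : \sum_g (g == f)%:R = 1 :> C.
  by rewrite (bigD1 f) //= eqxx big1 ?addr0 // => g /negPf ->.
have S3 : \sum_g (e == g)%:R * (g == f)%:R = (e == f)%:R :> C.
  rewrite (bigD1 e) //= eqxx mul1r big1 ?addr0 // => g.
  by rewrite eq_sym => /negPf ->; rewrite mul0r.
rewrite (eq_bigr (fun g => a * p * ((e == g)%:R * (g == f)%:R) +
  (a * N%:R^-1 * (q - p)) * (e == g)%:R + (N%:R^-1 * (b - a) * p) * (g == f)%:R +
  N%:R^-1 * (b - a) * N%:R^-1 * (q - p))) => [|g _]; last by ring.
rewrite !big_split /= -!mulr_sumr S1 S2 S3 sumr_const [#|_|]card_ord.
by rewrite -mulr_natr; field.
Qed.

Lemma sum_paths_cumulant w (e f : 'I_N) : w <> [::] ->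
  \sum_(s <- paths w e f) monochrome_weight cum s =
  diag_weight w * (e == f)%:R + N%:R^-1 * (ones_weight w - diag_weight w).
Proof.
move=> w0; have N0 : N%:R != 0 :> C by rewrite pnatr_eq0; case: N e {f} => // -[].
rewrite (eq_big_seq (fun s => cum [seq l.2 | l <- w] * (monochrome s)%:R)); last first.
  move=> s /paths_exponents sw.
  by rewrite /monochrome_weight sw; case: monochrome; rewrite ?mulr1 ?mulr0.
rewrite -mulr_sumr count_monochrome_paths // /diag_weight /ones_weight.
case: ifP => _; last by ring.
case: ifP => _; last by ring.
by case: ifP => _; field.
Qed.

(** Splitting off the first block turns the path sum into a matrix product, on which the two
    eigenvalues evolve separately by [sum_transfer]. *)
Lemma sum_paths_renewal w (e f : 'I_N) :
  \sum_(s <- paths w e f) renewal (monochrome_weight cum) s =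
  renewal diag_weight w * (e == f)%:R
  + N%:R^-1 * (renewal ones_weight w - renewal diag_weight w).
Proof.
have [n] := ubnP (size w); elim: n w e f => // n IH w e f wn.
have [->|/eqP w0] := eqVneq w [::].
  by rewrite sum_paths_nil !renewal_nil subrr mulr0 addr0 mul1r; case: eqP.
rewrite [renewal diag_weight w]renewalE // [renewal ones_weight w]renewalE //.
rewrite mulr_suml -sumrB mulr_sumr -big_split /=.
rewrite (eq_big_seq (fun s => \sum_(1 <= k < (size w).+1)
   monochrome_weight cum (take k s) *
   renewal (monochrome_weight cum) (drop k s))); last first.
  move=> s /paths_size sw; rewrite renewalE ?sw // => s0.
  by case: w0; apply: size0nil; rewrite -sw s0.
rewrite exchange_big /=; apply: eq_big_nat => k /andP[k0 kw].
rewrite -sum_transfer -[in LHS](cat_take_drop k w) sum_paths_cat.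
have tk : size (take k w) = k by rewrite size_takel.
apply: eq_bigr => g _; rewrite -sum_paths_cumulant => [|tk0]; last first.
  by rewrite tk0 /= in tk; rewrite -tk in k0.
rewrite -IH; last first.
  rewrite size_drop -subSn // leq_subLR (leq_trans wn) //.
  by rewrite -addn1 addnC leq_add2r.
rewrite mulr_suml; apply: eq_big_seq => s /paths_size.
rewrite tk => sk; rewrite mulr_sumr; apply: eq_bigr => t _.
by rewrite -sk take_size_cat // drop_size_cat.
Qed.

End TransferMatrix.

(** * Orders of decay *)

Section ComplexLimits.
Variable R : realType.
Implicit Types (u v : nat -> R[i]) (a b : R[i]).

Lemma ccvgD u v a b : ccvg u a -> ccvg v b -> ccvg (fun N => u N + v N) (a + b).
Proof.
by move=> ua vb; exact (@cvgD R[i] R[i]^o nat \oo%classic _ u v a b ua vb).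
Qed.

Lemma ccvgM u v a b : ccvg u a -> ccvg v b -> ccvg (fun N => u N * v N) (a * b).
Proof.
by move=> ua vb; exact (@cvgM R[i] nat \oo%classic _ u v a b ua vb).
Qed.

Lemma ccvg_cst a : ccvg (fun=> a) a.
Proof. exact: (@cvg_cst R[i]^o). Qed.

Lemma ccvg_eq u v a : ccvg u a -> (forall N, (0 < N)%N -> u N = v N) -> ccvg v a.
Proof.
move=> + uv; apply: cvg_trans; apply: near_eq_cvg.
by exists 1%N => // N /= N0; rewrite uv.
Qed.

Lemma ccvg_sum (T : eqType) (s : seq T) (u : T -> nat -> R[i]) (a : T -> R[i]) :
  {in s, forall k, ccvg (u k) (a k)} ->
  ccvg (fun N => \sum_(k <- s) u k N) (\sum_(k <- s) a k).
Proof.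
elim: s => [|k s IH] ua.
  by rewrite big_nil; apply: ccvg_eq (@ccvg_cst 0) _ => N _; rewrite big_nil.
rewrite big_cons; apply: ccvg_eq (ccvgD (ua k (mem_head _ _)) (IH _)) _ => [l ls|N _].
  by apply: ua; rewrite inE ls orbT.
by rewrite big_cons.
Qed.

Definition rpow (e : R) (N : nat) : R[i] := ((N%:R : R) `^ e)%:C%C.

Lemma rpowD e1 e2 N : (0 < N)%N -> rpow (e1 + e2) N = rpow e1 N * rpow e2 N.
Proof.
move=> N0; rewrite /rpow powRD; first by rewrite rmorphM.
by rewrite pnatr_eq0 -lt0n N0 implybT.
Qed.

Lemma rpow0 N : rpow 0 N = 1.
Proof. by rewrite /rpow powRr0. Qed.

Lemma rpow1 N : rpow 1 N = N%:R.
Proof. by rewrite /rpow powRr1 ?ler0n // rmorph_nat. Qed.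

Lemma rpowN_cvg0 d : 0 < d -> ccvg (rpow (- d)) 0.
Proof.
move=> d0; apply/(@cvgr0Pnorm_lt _ R[i]^o) => e /=.
rewrite ltcE => /andP[/eqP eIm eRe].
have -> : e = (complex.Re e)%:C%C by case: e eIm eRe => x y /= -> _.
near=> N.
have N0 : (0 < N%:R :> R).
  by rewrite ltr0n; near: N; exact: nbhs_infty_gt.
rewrite ger0_norm ?lecR ?ler0c ?powR_ge0 // ltcR powRN.
rewrite -[ltRHS]invrK ltf_pV2 ?posrE ?powR_gt0 ?invr_gt0 //.
(* The threshold is [e^(-1/d)]: beyond it, [N^d] exceeds [1/e]. *)
have -> : (complex.Re e)^-1 = ((complex.Re e)^-1 `^ d^-1) `^ d.
  by rewrite -powRrM mulVf ?gt_eqF // powRr1 // invr_ge0 ltW.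
rewrite gt0_ltr_powR ?nnegrE ?powR_ge0 ?ltW //.
by near: N; exact: nbhs_infty_gtr.
Unshelve. all: by end_near. Qed.

(** Decay of order [r] up to factors below every positive power of [N]. Orders add under products;
    order 0 still allows subpolynomial growth, a negative order some polynomial growth. *)
Definition vanishing (r : R) u := forall e, e < r -> ccvg (fun N => rpow e N * u N) 0.

Lemma vanishing_cvg0 r u : 0 < r -> vanishing r u -> ccvg u 0.
Proof. by move=> r0 /(_ 0 r0); move/ccvg_eq; apply=> N _; rewrite rpow0 mul1r. Qed.

Lemma vanishing_le s r u : r <= s -> vanishing s u -> vanishing r u.
Proof. by move=> rs us e er; apply: us; exact: lt_le_trans rs. Qed.

Lemma ccvg_vanishing u a : ccvg u a -> vanishing 0 u.
Proof.
move=> ua e e0.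
have e_cvg : ccvg (rpow e) 0.
  by rewrite -(opprK e); apply: rpowN_cvg0; rewrite oppr_gt0.
by have := ccvgM e_cvg ua; rewrite mul0r.
Qed.

Lemma vanishing0 r : vanishing r (fun=> 0).
Proof.
by move=> e _; apply: ccvg_eq (@ccvg_cst 0) _ => N _; rewrite mulr0.
Qed.

Lemma vanishing_eq r u v :
  vanishing r u -> (forall N, (0 < N)%N -> u N = v N) -> vanishing r v.
Proof. by move=> ur uv e /ur/ccvg_eq; apply=> N /uv ->. Qed.

Lemma vanishingD r u v : vanishing r u -> vanishing r v ->
  vanishing r (fun N => u N + v N).
Proof.
move=> ur vr e er; rewrite -(addr0 0).
by apply: ccvg_eq (ccvgD (ur e er) (vr e er)) _ => N _; rewrite mulrDr.
Qed.

Lemma vanishingN r u : vanishing r u -> vanishing r (fun N => - u N).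
Proof.
move=> ur e er; rewrite -(mulr0 (-1)).
by apply: ccvg_eq (ccvgM (@ccvg_cst (-1)) (ur e er)) _ => N _; rewrite mulN1r mulrN.
Qed.

Lemma vanishingM r s u v : vanishing r u -> vanishing s v ->
  vanishing (r + s) (fun N => u N * v N).
Proof.
move=> ur vs e ers; rewrite -(mulr0 0).
(* Half of the slack goes to each factor, keeping both exponents strictly below their orders. *)
pose d := (r + s - e) / 2.
have d0 : 0 < d by rewrite divr_gt0 // subr_gt0.
have e1 : r - d < r by rewrite ltrBlDr ltrDl.
have e2 : s - d < s by rewrite ltrBlDr ltrDl.
apply: ccvg_eq (ccvgM (ur _ e1) (vs _ e2)) _ => N N0.
have -> : e = (r - d) + (s - d) by rewrite /d; field.
by rewrite [in RHS]rpowD // mulrACA.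
Qed.

Lemma vanishing_sum r (T : eqType) (s : seq T) (u : T -> nat -> R[i]) :
  {in s, forall k, vanishing r (u k)} ->
  vanishing r (fun N => \sum_(k <- s) u k N).
Proof.
move=> ur e er.
have ue : {in s, forall k, ccvg (fun N => rpow e N * u k N) 0}.
  by move=> k /ur; exact.
have := ccvg_sum (a := fun=> 0) ue; rewrite big1 // => /ccvg_eq; apply=> N _.
by rewrite mulr_sumr.
Qed.

Lemma vanishing_rpow r : vanishing (- r) (rpow r).
Proof.
move=> e; rewrite -subr_gt0 => er.
apply: ccvg_eq (rpowN_cvg0 er) _ => N N0.
by rewrite -rpowD // opprB opprK addrC.
Qed.

Lemma vanishing_natr : vanishing (- 1) (fun N => N%:R).
Proof. by apply: vanishing_eq (@vanishing_rpow 1) _ => N _; rewrite rpow1. Qed.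

Lemma vanishing_invr : vanishing 1 (fun N => N%:R^-1).
Proof.
rewrite -(opprK 1); apply: vanishing_eq (@vanishing_rpow (- 1)) _ => N _.
by rewrite /rpow powRN powRr1 ?ler0n // fmorphV rmorph_nat.
Qed.

End ComplexLimits.

(** * The free star-algebra *)

Section FreeStarAlgebra.
Variables (C : numClosedFieldType) (I : choiceType).
Local Notation letter := (I * bool)%type.

Definition word_star (w : seq letter) : seq letter :=
  rev [seq (l.1, ~~ l.2) | l <- w].

Lemma word_starK : involutive word_star.
Proof.
move=> w; rewrite /word_star map_rev revK -map_comp map_id_in // => -[i b] _ /=.
by rewrite negbK.
Qed.

Lemma word_star_cat u v : word_star (u ++ v) = word_star v ++ word_star u.
Proof. by rewrite /word_star map_cat rev_cat. Qed.

(** The monoid algebra of the free monoid of words; as letters carry their exponent, this is the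
    free star-algebra on [I]. *)
Definition free_alg : Type := malg (fmonom letter) C.

HB.instance Definition _ := GRing.Lalgebra.on free_alg.

Implicit Types (a b : free_alg) (u v w : seq letter).

Definition monom w (c : C) : free_alg := mkmalgU (FMonom w) c.

HB.instance Definition _ w :=
  GRing.isZmodMorphism.Build C free_alg (monom w)
    (@monalgU_is_additive _ C (FMonom w)).

Definition fcoef w a : C := mcoeff (FMonom w) a.

HB.instance Definition _ w := GRing.isZmodMorphism.Build free_alg C (fcoef w)
  (@mcoeff_is_additive _ C (FMonom w)).

Definition supp a : seq (seq letter) := [seq fmonom_val k | k <- msupp a].

Lemma supp_uniq a : uniq (supp a).
Proof. by rewrite map_inj_uniq ?fset_uniq // => -[u] [v] /= ->. Qed.

Lemma mem_supp w a : (w \in supp a) = (fcoef w a != 0).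
Proof.
rewrite /fcoef mcoeff_neq0 -(@mem_map _ _ (@fmonom_val letter)) // => -[u] [v].
by move=> /= ->.
Qed.

Lemma fcoefZ w c a : fcoef w (c *: a) = c * fcoef w a.
Proof. exact: mcoeffZ. Qed.

Lemma fcoef_monom w u c : fcoef w (monom u c) = c *+ (u == w).
Proof. by rewrite /fcoef /monom mcoeffU. Qed.

Lemma free_algP a b : (forall w, fcoef w a = fcoef w b) <-> a = b.
Proof.
split=> [ab|->//]; apply/(malgP (a : malg (fmonom letter) C)) => -[w]; exact: ab.
Qed.

Lemma monomZ w c d : c *: monom w d = monom w (c * d).
Proof. by apply/free_algP => u; rewrite fcoefZ [RHS]fcoef_monom fcoef_monom mulrnAr. Qed.

Lemma monomM u v c d : monom u c * monom v d = monom (u ++ v) (c * d).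
Proof. by rewrite [LHS]fgmulUU; congr mkmalgU; exact: fmmulE. Qed.

Lemma monom1 : monom [::] 1 = 1.
Proof. by rewrite /monom -fmoneE. Qed.

Lemma free_algE a : a = \sum_(w <- supp a) monom w (fcoef w a).
Proof.
rewrite {1}(monalgE (a : malg (fmonom letter) C)) big_map.
by apply: eq_bigr => -[w].
Qed.

Lemma free_alg_scaleAr (c : C) a b : c *: (a * b) = a * (c *: b).
Proof.
rewrite [b]free_algE [a]free_algE.
rewrite [X in _ = _ * X]scaler_sumr !mulr_sumr scaler_sumr; apply: eq_bigr => w _.
rewrite !mulr_suml scaler_sumr; apply: eq_bigr => v _.
by rewrite monomZ [RHS]monomM monomM monomZ mulrCA.
Qed.

HB.instance Definition _ :=
  GRing.Lalgebra_isAlgebra.Build C free_alg free_alg_scaleAr.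

Definition free_star a : free_alg :=
  \sum_(w <- supp a) monom (word_star w) (fcoef w a)^*.

Lemma fcoef_star w a : fcoef w (free_star a) = (fcoef (word_star w) a)^*.
Proof.
rewrite raddf_sum /=.
under eq_bigr do rewrite fcoef_monom (can2_eq word_starK word_starK).
case: (boolP (word_star w \in supp a)) => [ain|].
  rewrite (bigD1_seq (word_star w)) ?supp_uniq //= eqxx mulr1n big1 ?addr0 //.
  by move=> u /negPf ->.
rewrite mem_supp negbK => a0; rewrite big_seq big1 ?(eqP a0) ?conjC0 // => u.
by case: eqP => // -> _; rewrite mulr1n (eqP a0) conjC0.
Qed.

Lemma free_starK : involutive free_star.
Proof.
by move=> a; apply/free_algP => w; rewrite !fcoef_star word_starK conjCK.
Qed.

Lemma free_starD a b : free_star (a + b) = free_star a + free_star b.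
Proof.
apply/free_algP => w; rewrite [LHS]fcoef_star [RHS]raddfD /= raddfD /= rmorphD.
by congr (_ + _); rewrite fcoef_star.
Qed.

Lemma free_starZ c a : free_star (c *: a) = c^* *: free_star a.
Proof. by apply/free_algP => w; rewrite fcoefZ [LHS]fcoef_star fcoef_star fcoefZ rmorphM. Qed.

Lemma free_star_monom w c : free_star (monom w c) = monom (word_star w) c^*.
Proof.
apply/free_algP => u; rewrite fcoef_star !fcoef_monom rmorphMn.
by rewrite (can2_eq word_starK word_starK).
Qed.

Lemma free_star_nmod_morphism : nmod_morphism free_star.
Proof.
split; last exact: free_starD.
by rewrite -[X in free_star X](scale0r 0) free_starZ conjC0 scale0r.
Qed.

HB.instance Definition _ := GRing.isNmodMorphism.Build free_alg free_alg
  free_star free_star_nmod_morphism.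

Lemma free_starM a b : free_star (a * b) = free_star b * free_star a.
Proof.
rewrite [b]free_algE [a]free_algE.
rewrite mulr_sumr [LHS]raddf_sum [in RHS]raddf_sum mulr_suml.
apply: eq_bigr => w _ /=.
rewrite mulr_suml 2!raddf_sum mulr_sumr; apply: eq_bigr => v _ /=.
by rewrite monomM 3!free_star_monom monomM word_star_cat rmorphM mulrC.
Qed.

HB.instance Definition _ := @Algebra_isStarAlgebra.Build C free_alg
  free_star free_starK free_starD free_starZ free_starM.

Lemma supp_add w a b : w \in supp (a + b) -> (w \in supp a) || (w \in supp b).
Proof.
rewrite !mem_supp raddfD /=; case: (eqVneq (fcoef w a) 0) => //= ->.
by rewrite add0r.
Qed.

Lemma supp_mul w a b : w \in supp (a * b) ->
  exists u v, [/\ u \in supp a, v \in supp b & w = u ++ v].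
Proof.
move=> /mapP[k /(@msuppM_le (fmonom letter) C a b)[k1 [k2 [k1a k2b ->]]] ->].
exists (fmonom_val k1), (fmonom_val k2); split; try by apply: map_f.
exact: fmM.
Qed.

Definition gen (i : I) : free_alg := monom [:: (i, false)] 1.

(** Elements supported on nonempty words of a single index form a nonunital star-subalgebra
    containing [gen i]. Excluding the empty word keeps the unit out. *)
Lemma gen_supp i a : star_generated (gen i) a ->
  {in supp a, forall w, w != [::] /\ all (fun l => l.1 == i) w}.
Proof.
move: a; apply: (@smallest_sub _ _ _
  [set a : free_alg | {in supp a, forall w,
     w != [::] /\ all (fun l => l.1 == i) w}]%classic); last first.
  move=> _ -> w; rewrite mem_supp fcoef_monom.
  by case: ([:: _] =P w) => [<- _|_]; rewrite ?mulr0n /= eqxx.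
split.
- by move=> w; rewrite mem_supp raddf0 eqxx.
- by move=> b c Pb Pc w /supp_add/orP[/Pb|/Pc].
- move=> c b Pb w; rewrite mem_supp fcoefZ mulf_eq0 negb_or => /andP[_].
  by rewrite -mem_supp => /Pb.
- move=> b c Pb Pc w /supp_mul[u [v [/Pb[u0 ui] /Pc[v0 vi] ->]]].
  rewrite all_cat ui vi; split=> //; apply: contra u0.
  by rewrite -!size_eq0 size_cat addn_eq0 => /andP[].
move=> b Pb w; rewrite mem_supp fcoef_star conjC_eq0 -mem_supp => /Pb[w0 wi].
split; first by apply: contra w0; rewrite -!size_eq0 size_rev size_map.
by move: wi; rewrite all_rev all_map.
Qed.

Section LinearExtension.
Variable L : seq letter -> C.

Definition lin_ext a : C := \sum_(w <- supp a) fcoef w a * L w.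

Lemma lin_extEw (s : seq (seq letter)) a : uniq s -> {subset supp a <= s} ->
  lin_ext a = \sum_(w <- s) fcoef w a * L w.
Proof.
move=> us sub.
rewrite [RHS](bigID (mem (supp a))) /= [X in _ + X]big1 ?addr0; last first.
  by move=> w; rewrite mem_supp negbK => /eqP ->; rewrite mul0r.
rewrite -[RHS]big_filter; apply/perm_big/uniq_perm; first exact: supp_uniq.
  exact: filter_uniq.
by move=> w; rewrite mem_filter; case: (boolP (w \in supp a)) => //= /sub ->.
Qed.

Lemma lin_ext_linear : scalar lin_ext.
Proof.
move=> c a b; pose s := undup (supp (c *: a + b) ++ supp a ++ supp b).
have us : uniq s by exact: undup_uniq.
rewrite !(@lin_extEw s) // => [|w|w|w]; rewrite ?mem_undup ?mem_cat;
  do ?by move=> ->; rewrite ?orbT.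
rewrite mulr_sumr -big_split; apply: eq_bigr => w _ /=.
by rewrite raddfD /= fcoefZ mulrDl mulrA.
Qed.

HB.instance Definition _ :=
  GRing.isLinear.Build C free_alg C _ lin_ext lin_ext_linear.

Lemma lin_ext_monom w c : lin_ext (monom w c) = c * L w.
Proof.
rewrite (@lin_extEw [:: w]) ?big_seq1 ?fcoef_monom ?eqxx // => u.
by rewrite mem_supp fcoef_monom inE [u == w]eq_sym; case: (w == u); rewrite ?eqxx.
Qed.

Hypothesis L1 : L [::] = 1.
Hypothesis L_factorizing : factorizing L.

Lemma lin_ext1 : lin_ext 1 = 1.
Proof. by rewrite -monom1 lin_ext_monom L1 mulr1. Qed.

Lemma lin_extM a b :
  {in supp a & supp b, forall u v, L (u ++ v) = L u * L v} ->
  lin_ext (a * b) = lin_ext a * lin_ext b.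
Proof.
move=> ab; rewrite {1}[b]free_algE {1}[a]free_algE mulr_suml raddf_sum.
rewrite [lin_ext a]/lin_ext mulr_suml; apply: eq_big_seq => u ua /=.
rewrite mulr_sumr raddf_sum [lin_ext b]/lin_ext mulr_sumr.
apply: eq_big_seq => v vb /=.
by rewrite monomM lin_ext_monom ab // mulrACA.
Qed.

(** Peel off the first factor: its words end in index [i 0], while those of the remaining product
    begin with index [i 1], so [L] factorizes at the junction. *)
Lemma gen_independent : boolean_independent_vars (lin_ext : {scalar _}) gen.
Proof.
(* The induction also carries the index of the first letter of every word in the support of the
   product. *)
suff H (r : nat) (i : nat -> I) (a : nat -> free_alg) :
    (forall k, (k < r)%N -> star_generated (gen (i k)) (a k)) ->
    (forall k, (k.+1 < r)%N -> i k <> i k.+1) ->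
    lin_ext (\prod_(k < r) a k) = \prod_(k < r) lin_ext (a k) /\
    ((0 < r)%N -> {in supp (\prod_(k < r) a k), forall w,
       exists (e : bool) v, w = (i 0%N, e) :: v}).
  by move=> r i a _ Sa ia; have [] := H r i a Sa ia.
elim: r i a => [|r IH] i a Sa ia; first by rewrite !big_ord0 lin_ext1.
rewrite !big_ord_recl /=.
have [] := IH (i \o succn) (a \o succn) => [k kr|k kr|]; [exact: Sa|exact: ia|].
set y := \prod_(k < r) _; move=> psiy suppy.
have supp0 : {in supp (a 0%N), forall w, exists (e : bool) v, w = (i 0%N, e) :: v}.
  move=> w /(gen_supp (Sa 0%N isT))[]; case: w => // -[j b] v _ /= /andP[/eqP -> _].
  by exists b, v.
split; last first.
  move=> _ w /supp_mul[u [v [/supp0[b [u' ->]] _ ->]]].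
  by exists b, (u' ++ v).
rewrite lin_extM ?psiy // => u v ua vb.
have {ua}[u0 ui] := gen_supp (Sa 0%N isT) ua.
(* If no factor remains, the product is 1, supported on the empty word. *)
case: r {IH} @y psiy suppy Sa ia vb => [|r] y _ suppy Sa ia vb.
  move: vb; rewrite /y big_ord0 -monom1 mem_supp fcoef_monom.
  by case: ([::] =P v) => [<- _|_]; rewrite ?mulr0n ?eqxx // cats0 L1 mulr1.
have [b [v' ->]] := suppy isT _ vb.
case/lastP: u u0 ui => // u l _; rewrite all_rcons => /andP[/eqP il _].
by rewrite L_factorizing //= il; apply/eqP/ia.
Qed.

End LinearExtension.
End FreeStarAlgebra.

(** * Asymptotics of the traces *)

Section Asymptotics.
Variable R : realType.

Section Cumulants.
Variables (T : eqType) (m : nat -> seq T -> R[i]).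
Hypothesis m_vanishing : forall w, w <> [::] -> vanishing 1 (m ^~ w).

Let drop_neq0 (k : nat) (w : seq T) : (k < size w)%N -> drop k w <> [::].
Proof.
by move=> kw /(congr1 size)/eqP; rewrite size_drop subn_eq0 leqNgt kw.
Qed.

(** The correction terms are products of a cumulant and a moment, each of order 1, so they have
    order 2. *)
Lemma cumulant_vanishing w : w <> [::] ->
  vanishing 1 (fun N => cumulant (m N) w).
Proof.
have [n] := ubnP (size w); elim: n w => // n IH w wn w0.
apply: vanishing_eq (vanishingD (m_vanishing w0) (vanishingN (vanishing_sum
  (s := index_iota 1 (size w))
  (u := fun k N => cumulant (m N) (take k w) * m N (drop k w)) _))) _ => [k|N _].
  rewrite mem_index_iota => /andP[k0 kw].
  apply: (@vanishing_le _ (1 + 1)); first by rewrite lerDl.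
  apply: vanishingM; last exact/m_vanishing/drop_neq0.
  apply: IH => [|/(congr1 size)/eqP]; rewrite size_takel ?(ltnW kw) //.
    exact: leq_trans kw _.
  by rewrite eqn0Ngt k0.
by rewrite cumulantE.
Qed.

(** After multiplication by [N] the correction terms still have order 1 and vanish, so moment and
    cumulant share the limit. *)
Lemma cumulant_ccvg w a : ccvg (fun N => N%:R * m N w) a ->
  ccvg (fun N => N%:R * cumulant (m N) w) a.
Proof.
move=> wa; rewrite -[a]addr0.
have S0 : vanishing 1 (fun N => \sum_(1 <= k < size w)
    N%:R * (cumulant (m N) (take k w) * m N (drop k w))).
  apply: vanishing_sum => k; rewrite mem_index_iota => /andP[k0 kw].
  have -> : 1 = -1 + (1 + 1) :> R by ring.
  apply: vanishingM (@vanishing_natr R) _.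
  apply: vanishingM; last exact/m_vanishing/drop_neq0.
  apply: cumulant_vanishing => /(congr1 size)/eqP; rewrite size_takel ?(ltnW kw) //.
  by rewrite eqn0Ngt k0.
apply: ccvg_eq (ccvgD wa (vanishing_cvg0 ltr01 (vanishingN S0))) _ => N _.
by rewrite -mulr_sumr cumulantE mulrBr.
Qed.

End Cumulants.

Section Renewals.
Variables (T : eqType) (g : nat -> seq T -> R[i]).

Lemma renewal_ccvg (h : seq T -> R[i]) w :
  (forall w, w <> [::] -> ccvg (g ^~ w) (h w)) ->
  ccvg (fun N => renewal (g N) w) (renewal h w).
Proof.
move=> gh; have [n] := ubnP (size w); elim: n w => // n IH w wn.
have [->|/eqP w0] := eqVneq w [::].
  by rewrite renewal_nil; apply: ccvg_eq (@ccvg_cst _ 1) _ => N _; rewrite renewal_nil.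
rewrite renewalE //; apply: ccvg_eq (ccvg_sum (s := index_iota 1 (size w).+1)
  (u := fun k N => g N (take k w) * renewal (g N) (drop k w)) _) _ => [k|N _].
  rewrite mem_index_iota => /andP[k0 kw]; apply: ccvgM.
    apply: gh => /(congr1 size)/eqP; rewrite size_takel //.
    by rewrite eqn0Ngt k0.
  by apply: IH; rewrite size_drop -subSn // leq_subLR (leq_trans wn) // -add1n leq_add2r.
by rewrite renewalE.
Qed.

Lemma renewal_vanishing w :
  (forall w, w <> [::] -> vanishing 0 (g ^~ w)) ->
  vanishing 0 (fun N => renewal (g N) w).
Proof.
move=> gh; have [n] := ubnP (size w); elim: n w => // n IH w wn.
have [->|/eqP w0] := eqVneq w [::].
  apply: vanishing_eq (ccvg_vanishing (@ccvg_cst _ 1)) _ => N _.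
  by rewrite renewal_nil.
apply: vanishing_eq (vanishing_sum (s := index_iota 1 (size w).+1)
  (u := fun k N => g N (take k w) * renewal (g N) (drop k w)) _) _ => [k|N _].
  rewrite mem_index_iota => /andP[k0 kw]; rewrite -[0]addr0; apply: vanishingM.
    apply: gh => /(congr1 size)/eqP; rewrite size_takel //.
    by rewrite eqn0Ngt k0.
  by apply: IH; rewrite size_drop -subSn // leq_subLR (leq_trans wn) // -add1n leq_add2r.
by rewrite renewalE.
Qed.

End Renewals.

Section Weights.
Variables (I : eqType) (cum : nat -> seq bool -> R[i]) (alpha beta : nat -> R[i]).
Hypothesis cum_vanishing : forall xi, xi <> [::] -> vanishing 1 (cum ^~ xi).
Hypothesis cum_ccvg : forall xi, xi <> [::] -> alternating_seq xi ->
  ~~ odd (size xi) -> ccvg (fun N => N%:R * cum N xi)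
    (if head false xi then beta (size xi)./2 else alpha (size xi)./2).
Implicit Types w : seq (I * bool).

(** An alternating word of even length is a power of [x^* x] if it starts with a star, which gives
    [beta], and a power of [x x^*] otherwise, which gives [alpha]. *)
Definition limit_weight w : R[i] :=
  let xi := [seq l.2 | l <- w] in
  if [&& monochrome w, alternating_seq xi & ~~ odd (size w)] then
    if head false xi then beta (size w)./2 else alpha (size w)./2
  else 0.

Let map_neq0 w : w <> [::] -> [seq l.2 | l <- w] <> [::].
Proof. by case: w. Qed.

(** Odd alternating blocks weigh 0 for every [N]; non-alternating ones lack the factor [N] and tend
    to 0; on even alternating ones the limit is assumed. *)
Lemma diag_weight_ccvg w : w <> [::] ->
  ccvg (fun N => diag_weight (cum N) N w) (limit_weight w).
Proof.
move=> w0; rewrite /diag_weight /limit_weight.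
case: monochrome => /=; last exact: ccvg_cst.
case: (boolP (alternating_seq _)) => [alt|_] /=; last first.
  exact (vanishing_cvg0 ltr01 (cum_vanishing (map_neq0 w0))).
case: (boolP (odd _)) => [_|even_w]; first exact: ccvg_cst.
by have := cum_ccvg (map_neq0 w0) alt; rewrite size_map; exact.
Qed.

(** Odd alternating cumulants times [N] need not converge, but order 0 suffices because the trace
    carries a further [N^-1]. *)
Lemma ones_weight_vanishing w : w <> [::] ->
  vanishing 0 (fun N => ones_weight (cum N) N w).
Proof.
move=> w0; have cw := cum_vanishing (map_neq0 w0); rewrite /ones_weight.
case: monochrome; last exact: vanishing0.
case: (alternating_seq _); last exact: vanishing_le ler01 cw.
rewrite -(addNr 1); exact: vanishingM (@vanishing_natr R) cw.
Qed.

(** [P] converges and [S] has order 0, so [N^-1 (S - P)] has order 1 and drops out. *)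
Lemma renewal_weights_ccvg w :
  ccvg (fun N => renewal (diag_weight (cum N) N) w + N%:R^-1 *
         (renewal (ones_weight (cum N) N) w - renewal (diag_weight (cum N) N) w))
       (renewal limit_weight w).
Proof.
have P_cvg := renewal_ccvg (w := w) diag_weight_ccvg.
have S_slow := renewal_vanishing w ones_weight_vanishing.
have := vanishingM (@vanishing_invr R)
  (vanishingD S_slow (vanishingN (ccvg_vanishing P_cvg))).
by rewrite addr0 => /(vanishing_cvg0 ltr01)/(ccvgD P_cvg); rewrite addr0.
Qed.

Lemma limit_weight_factorizing : factorizing (renewal limit_weight).
Proof.
by apply: renewal_factorizing => w /negPf mw; rewrite /limit_weight mw.
Qed.

End Weights.

End Asymptotics.

Lemma star_moment_alternating (C : numClosedFieldType) (A : starAlgType C)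
    (phi : {scalar A}) (a : A) (xi : seq bool) :
  alternating_seq xi -> ~~ odd (size xi) ->
  star_moment phi xi a =
    phi (if head false xi then (star a * a) ^+ (size xi)./2
         else (a * star a) ^+ (size xi)./2).
Proof.
move=> alt even_xi; congr (phi _).
have [n] := ubnP (size xi); elim: n xi alt even_xi => // n IH.
move=> [|e [|e' xi]] // alt even_xi xin; first by rewrite big_nil.
move: alt => /= /andP[ee' alt].
rewrite !big_cons IH; last 3 first.
- by move: alt => /path_sorted.
- by move: even_xi => /=; rewrite negbK.
- by rewrite -ltnS (leq_trans _ xin).
(* Alternation makes a nonempty tail start with [e] again; for an empty tail both powers are 1. *)
rewrite !exprS mulrA; case: e {even_xi xin} ee' alt; case: e' => // _;
  case: xi => [|[] xi] //=; by rewrite !expr0.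
Qed.

Section Traces.
Variables (R : realType) (A : starAlgType R[i]) (phi : {scalar A}) (m : nat).
Hypothesis phi1 : phi 1 = 1.
Implicit Type w : seq ('I_m * bool).

Lemma trstate_word (N : nat) (y : 'I_m -> 'I_N -> 'I_N -> A) (a : A) w :
  (0 < N)%N ->
  boolean_independent_vars phi
    (fun s : 'I_m * ('I_N * 'I_N) => y s.1 s.2.1 s.2.2) ->
  (forall s : 'I_m * ('I_N * 'I_N),
     identically_distributed phi (y s.1 s.2.1 s.2.2) a) ->
  let cum := cumulant (star_moment phi ^~ a) in
  trstate phi (\prod_(l <- w) starpow (@starmx _ A N) l.2
                 (\matrix_(i, j) y l.1 i j)) =
  renewal (diag_weight cum N) w + N%:R^-1 *
    (renewal (ones_weight cum N) w - renewal (diag_weight cum N) w).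
Proof.
move=> N0 y_indep ya /=; rewrite /trstate.
(* The value does not depend on the diagonal position, so averaging returns it. *)
rewrite (eq_bigr (fun=> renewal (diag_weight (cumulant (star_moment phi ^~ a)) N) w
  + N%:R^-1 * (renewal (ones_weight (cumulant (star_moment phi ^~ a)) N) w
     - renewal (diag_weight (cumulant (star_moment phi ^~ a)) N) w))) => [|e _].
  rewrite sumr_const [#|_|]card_ord mulrnAr -mulrnAl.
  rewrite -[X in X * _]mulr_natr mulVf ?mul1r //.
  by rewrite pnatr_eq0 -lt0n.
have := sum_paths_renewal (cumulant (star_moment phi ^~ a)) w e e.
rewrite eqxx mulr1 => <-.
rewrite mx_word_entry raddf_sum; apply: eq_bigr => s _ /=.
exact: (word_prod_renewal phi1 y_indep ya).
Qed.

Lemma trstate_nceval (N : nat) (p : ncpoly R[i] m) (X : 'I_m -> 'M[A]_N) :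
  trstate phi (nceval cscalemx (@starmx _ A N) p X) =
  \sum_(w <- finsupp p) p w *
     trstate phi (\prod_(l <- w) starpow (@starmx _ A N) l.2 (X l.1)).
Proof.
rewrite /trstate /nceval.
under eq_bigr do rewrite summxE raddf_sum /=.
rewrite exchange_big mulr_sumr /=; apply: eq_bigr => w _.
rewrite [RHS]mulrCA [in RHS]mulr_sumr; congr (_ * _); apply: eq_bigr => e _.
by rewrite mxE linearZ.
Qed.

Lemma lin_ext_nceval (L : seq ('I_m * bool) -> R[i]) (p : ncpoly R[i] m) :
  lin_ext L (nceval *:%R (@star _ (free_alg R[i] 'I_m)) p (@gen _ _)) =
  \sum_(w <- finsupp p) p w * L w.
Proof.
rewrite /nceval raddf_sum; apply: eq_bigr => w _ /=.
have -> : \prod_(l <- w) starpow star l.2 (gen _ l.1) = monom w 1 :> free_alg R[i] 'I_m.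
  elim: w => [|[k e] w IH]; first by rewrite big_nil monom1.
  rewrite big_cons IH -[in RHS](mulr1 1) -cat1s -monomM; congr (_ * _).
  by case: e; rewrite //= /gen [LHS]free_star_monom conjC1.
by rewrite monomZ mulr1 lin_ext_monom.
Qed.

End Traces.

Theorem theorem3p5 (R : realType) (A : starAlgType R[i]) (phi : {scalar A})
    (phi1 : phi 1 = 1) (m : nat) (m_gt0 : (0 < m)%N)
    (x : forall (k : 'I_m) (i j N : nat), A)
    (x_idd : forall N : nat, (0 < N)%N ->
       forall s t : 'I_m * ('I_N * 'I_N),
         identically_distributed phi (x s.1 s.2.1 s.2.2 N)
                                     (x t.1 t.2.1 t.2.2 N))
    (x_indep : forall N : nat, (0 < N)%N ->
       boolean_independent_vars phi
         (fun s : 'I_m * ('I_N * 'I_N) => x s.1 s.2.1 s.2.2 N))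
    (alpha beta : nat -> R[i])
    (x_alpha : forall (k : 'I_m) (i j p : nat), (0 < p)%N ->
       ccvg (fun N => N%:R * phi ((x k i j N * star (x k i j N)) ^+ p))
            (alpha p))
    (x_beta : forall (k : 'I_m) (i j p : nat), (0 < p)%N ->
       ccvg (fun N => N%:R * phi ((star (x k i j N) * x k i j N) ^+ p))
            (beta p))
    (x_moments : forall (k : 'I_m) (i j : nat) (eps : R) (xi : seq bool),
       eps < 1 -> xi <> [::] ->
       ccvg (fun N => ((N%:R : R) `^ eps)%:C%C * star_moment phi xi (x k i j N))
            0) :
  asymptotically_boolean_independent phi
    (fun (N : nat) (k : 'I_m) => \matrix_(i < N, j < N) x k i j N).
Proof.
(* One entry stands for the common distribution; [m_gt0] supplies its matrix index. *)
pose a N := x (Ordinal m_gt0) 0%N 0%N N.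
pose cum N := cumulant (star_moment phi ^~ (a N)).
have a_vanishing xi : xi <> [::] -> vanishing 1 (fun N => star_moment phi xi (a N)).
  by move=> xi0 e e1; exact: x_moments.
have cum_vanishing xi : xi <> [::] -> vanishing 1 (cum ^~ xi).
  exact: cumulant_vanishing.
have cum_ccvg xi : xi <> [::] -> alternating_seq xi -> ~~ odd (size xi) ->
    ccvg (fun N => N%:R * cum N xi)
      (if head false xi then beta (size xi)./2 else alpha (size xi)./2).
  move=> xi0 alt even_xi; apply: cumulant_ccvg => //.
  (* The limits are given for positive exponents only; a nonempty word of even length has at least
     two letters. *)
  have half_gt0 : (0 < (size xi)./2)%N.
    by case: xi xi0 alt even_xi => [|? [|? ?]].
  under eq_fun do rewrite star_moment_alternating //.
  by case: head; [exact: x_beta | exact: x_alpha].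
pose L := renewal (@limit_weight R 'I_m alpha beta).
have L_factorizing : factorizing L by exact: limit_weight_factorizing.
exists (free_alg R[i] 'I_m), (lin_ext L), (@gen _ _); split.
- exact: lin_ext1.
- exact: gen_independent.
move=> p; rewrite [X in ccvg _ X](lin_ext_nceval L p).
apply: ccvg_eq (ccvg_sum (u := fun w N => p w *
  (renewal (diag_weight (cum N) N) w + N%:R^-1 *
    (renewal (ones_weight (cum N) N) w - renewal (diag_weight (cum N) N) w)))
  _) _ => [w _|N N0].
  refine (ccvgM (@ccvg_cst R (p w)) _).
  exact: (renewal_weights_ccvg cum_vanishing cum_ccvg).
have a_idd s := x_idd N N0 s (Ordinal m_gt0, (Ordinal N0, Ordinal N0)).
rewrite trstate_nceval; apply: eq_bigr => w _; congr (_ * _); apply/esym.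
exact: (@trstate_word _ _ _ _ phi1 N (fun k i j => x k i j N) (a N) w N0
  (x_indep N N0) a_idd).
Qed.
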